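(* Let $n\ge 2$ and let $\ell$ be a line in $\mathbb P^n$ (over $\mathbb C$) such that $\ell\cap\Delta_{n-2}=\emptyset$. Then: (i) $\ell^{\circ n}=\{P^{\star n}\mid P\in\ell\}$ is a rational normal curve of $\mathbb P^n$; (ii) for every $P\in\ell$ and every $1\le d\le n-1$, the linear subspace of dimension $d$ osculating to $\ell^{\circ n}$ at $P^{\star n}$ (whose intersection with $\ell^{\circ n}$ is supported only at $P^{\star n}$) is $P^{\star(n-d)}\star\ell^{\star d}$; in particular, the osculating hyperplane to $\ell^{\circ n}$ at $P^{\star n}$ is $P\star\ell^{\star(n-1)}$; (iii) for each set of $n$ distinct points $P_1,\ldots,P_n\in\ell$ we have $$P_1\star P_2\star\cdots\star P_n=(P_1\star\ell^{\star(n-1)})\cap\cdots\cap(P_n\star\ell^{\star(n-1)}).$$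
   Context: Work over $\mathbb C$. $\Delta_i\subseteq\mathbb P^n$ is the set of points having at most $i+1$ non-zero coordinates. For $P=[a_0:\cdots:a_n]$ and $Q=[b_0:\cdots:b_n]$ in $\mathbb P^n$ such that $a_i\ne0$ and $b_i\neq 0$ for some common index $i$, the Hadamard product is defined and equals $P\star Q=[a_0b_0:\cdots:a_nb_n]$. For varieties $X,Y\subseteq\mathbb P^n$, the Hadamard product is the Zariski closure $X\star Y=\overline{\{P\star Q\mid P\in X,\ Q\in Y,\ P\star Q\text{ is defined}\}}$. Hadamard powers: $X^{\star 1}=X$ and $X^{\star r}=X^{\star(r-1)}\star X$ for $r\ge2$ (for a point $P$, $P^{\star r}$ is the point obtained by raising each coordinate to the $r$-th power). A point $P$ is identified with the variety $\{P\}$ in expressions such as $P\star \ell$. For a linear space $V$, $V^{\circ r}=\{P^{\star r}\mid P\in V\}$ is the $r$-th coordinate-wise power of $V$. A rational normal curve of $\mathbb P^n$ is a curve projectively equivalent to the image of $\mathbb P^1$ under the map given by all monomials of degree $n$. The osculating linear space of dimension $d$ to a rational normal curve $\gamma\subseteq\mathbb P^n$ at a point $R\in\gamma$ is the unique $d$-dimensional linear subspace meeting $\gamma$ at $R$ with multiplicity at least $d+1$ (for $d=1$ it is the tangent line at $R$). *)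

(* Defs.v *)
From HB Require Import structures.
From mathcomp Require Import all_boot all_order all_algebra.
From mathcomp Require Import classical_sets reals complex.
From mathcomp Require Import mpoly.

Set Implicit Arguments.
Unset Strict Implicit.
Unset Printing Implicit Defensive.

Import GRing.Theory.

Local Open Scope classical_set_scope.
Local Open Scope ring_scope.

Section ProjectiveSpace.
Variables (F : fieldType) (n : nat).

(* A point of P^n is a line through the origin of F^(n+1). *)
Definition proj_point := {V : {vspace 'rV[F]_n.+1} | \dim V == 1%N}.

(* A vector of homogeneous coordinates of P; it is non-zero. *)
Definition rep (P : proj_point) : 'rV[F]_n.+1 := vpick (val P).

Lemma dim_one_line : \dim <[const_mx 1 : 'rV[F]_n.+1]>%VS == 1%N.
Proof.
rewrite dim_vline eqb1; apply/eqP => /matrixP/(_ 0 0)/eqP.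
by rewrite !mxE oner_eq0.
Qed.

(* The point [1 : ... : 1], neutral for the Hadamard product. *)
Definition hone : proj_point := exist _ <[const_mx 1]>%VS dim_one_line.

(* [v_0 : ... : v_n]; the value at v = 0 is irrelevant. *)
Definition mkpoint (v : 'rV[F]_n.+1) : proj_point := insubd hone <[v]>%VS.

(* Points with at most i+1 non-zero coordinates. *)
Definition Delta (i : nat) : set proj_point :=
  [set P | (#|[pred j | rep P 0%R j != 0%R]| <= i.+1)%N].

Definition linear_subspace (d : nat) (X : set proj_point) : Prop :=
  exists2 L : {vspace 'rV[F]_n.+1},
    \dim L = d.+1 & X = [set P | (val P <= L)%VS].

Definition vanishes_at (f : {mpoly F[n.+1]}) (P : proj_point) : Prop :=
  f.@[rep P 0] = 0.

Definition zariski_closed (Z : set proj_point) : Prop :=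
  exists2 S : set {mpoly F[n.+1]},
    (forall f, S f -> exists k : nat, f \is k.-homog) &
    Z = [set P | forall f, S f -> vanishes_at f P].

Definition zariski_closure (X : set proj_point) : set proj_point :=
  smallest zariski_closed X.

(* Meaningful only when [hdefined P Q]. *)
Definition hmul (P Q : proj_point) : proj_point :=
  mkpoint (\row_j (rep P 0 j * rep Q 0 j)).

Definition hdefined (P Q : proj_point) : Prop :=
  exists j, rep P 0 j != 0 /\ rep Q 0 j != 0.

Definition hprod (X Y : set proj_point) : set proj_point :=
  zariski_closure
    [set S | exists P Q, [/\ X P, Y Q, hdefined P Q & S = hmul P Q]].

(* X^{*r} for r >= 1; the value at r = 0 is irrelevant. *)
Definition hpow (X : set proj_point) (r : nat) : set proj_point :=
  iter r.-1 (fun Y => hprod Y X) X.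

Definition ppow (P : proj_point) (r : nat) : proj_point :=
  mkpoint (\row_j (rep P 0 j ^+ r)).

Definition coord_pow (X : set proj_point) (r : nat) : set proj_point :=
  (fun P => ppow P r) @` X.

Definition proj_map (M : 'M[F]_n.+1) (P : proj_point) : proj_point :=
  mkpoint (rep P *m M).

(* The ideal of X, as the polynomials vanishing on the affine cone over X
   (this is the homogeneous ideal of X since F is infinite in our use). *)
Definition vanishing_ideal (X : set proj_point) : set {mpoly F[n.+1]} :=
  [set f | forall P, X P -> forall v, v \in val P -> f.@[v 0] = 0].

(* The homogeneous polynomial f of degree k represents an element of the
   ideal of O_{P^n,P} generated by I(X) + I(Y), i.e. of the ideal of the
   scheme-theoretic intersection of X and Y in the local ring at P: this means
   that h f is in I(X) + I(Y) for some homogeneous h not vanishing at P. *)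
Definition local_ideal (X Y : set proj_point) (P : proj_point) :
    set {mpoly F[n.+1]} :=
  [set f | exists (e : nat) (h a b : {mpoly F[n.+1]}),
    [/\ h \is e.-homog, ~ vanishes_at h P,
        vanishing_ideal X a, vanishing_ideal Y b & h * f = a + b]].

(* X and Y meet at P with multiplicity at least m, the multiplicity being
   dim_F O_{P^n,P} / (I(X) + I(Y)): there are m linearly independent
   classes, written as fractions f_i / g with a common denominator g; as g is
   a unit at P it plays no role, and only the numerators f_i appear. *)
Definition meets_with_mult_ge (X Y : set proj_point) (P : proj_point)
    (m : nat) : Prop :=
  exists (k : nat) (f : 'I_m -> {mpoly F[n.+1]}),
    (forall i, f i \is k.-homog) /\
    forall c : 'I_m -> F,
      local_ideal X Y P (\sum_(i < m) c i *: f i) -> forall i, c i = 0.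

(* T is the unique d-dimensional linear subspace meeting X at P with
   multiplicity at least d+1. *)
Definition osculating_space (d : nat) (X : set proj_point) (P : proj_point)
    (T : set proj_point) : Prop :=
  [/\ linear_subspace d T, meets_with_mult_ge X T P d.+1 &
      forall T', linear_subspace d T' -> meets_with_mult_ge X T' P d.+1 ->
        T' = T].

End ProjectiveSpace.

Section RationalNormalCurve.
Variables (F : fieldType) (n : nat).

(* [s : t] |-> [s^n : s^(n-1) t : ... : t^n] *)
Definition veronese (Q : proj_point F 1) : proj_point F n :=
  let s := rep Q 0 ord0 in let t := rep Q 0 ord_max in
  mkpoint (\row_(i < n.+1) (s ^+ (n - i) * t ^+ i)).

Definition rational_normal_curve (X : set (proj_point F n)) : Prop :=
  exists2 M : 'M[F]_n.+1, M \in unitmx &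
    X = proj_map M @` range veronese.

End RationalNormalCurve.

(* Main.v *)
(* Choose a basis p, r of the plane of ell.  The points of ell are the vectors
   (a p_j + b r_j)_j, and the hypothesis on Delta_(n-2) says that the n+1 points
   [p_j : r_j] of P^1 are distinct.  Evaluating binary forms of degree d at these
   points sends products of linear forms to Hadamard products; as every binary
   form over an algebraically closed field splits, ell^{*d} is the linear space
   of all evaluations of forms of degree d, and P^{*(n-d)} * ell^{*d} is the
   space of the forms divisible by l^(n-d), where l is the linear form of P.
   For d = n evaluation is an isomorphism, since a form of degree n vanishing
   at n+1 points is zero.  Hence ell^{o n} corresponds to the n-th powers of
   linear forms, i.e. it is a rational normal curve; its osculating spaces at
   l^n are the spaces of forms divisible by l^(n-d); and the forms divisible by
   n pairwise independent linear forms are the multiples of their product.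

   Multiplicities at P^{*n} are computed after pulling polynomials back along
   the parametrization t |-> (p + t r)^{o n}. *)

Require Import Defs.
From mathcomp Require Import all_boot all_order all_algebra.
From mathcomp Require Import classical_sets reals complex.
From mathcomp Require Import mpoly ring.

Set Implicit Arguments.
Unset Strict Implicit.
Unset Printing Implicit Defensive.

Import GRing.Theory Num.Theory.

Local Open Scope classical_set_scope.
Local Open Scope ring_scope.

(** * Homogeneous coordinates, and linear subspaces as Zariski closed sets *)

Section Points.
Variables (F : fieldType) (n : nat).
Implicit Types (P Q : proj_point F n) (u v : 'rV[F]_n.+1).
Implicit Types (L : {vspace 'rV[F]_n.+1}).

Lemma rep_neq0 P : rep P != 0.
Proof. by rewrite /rep vpick0 -dimv_eq0 (eqP (valP P)). Qed.

Lemma val_rep P : val P = <[rep P]>%VS.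
Proof.
apply/esym/eqP; rewrite eqEdim -memvE memv_pick /=.
by rewrite (eqP (valP P)) dim_vline rep_neq0.
Qed.

Lemma sub_rep P L : (val P <= L)%VS = (rep P \in L).
Proof. by rewrite val_rep memvE. Qed.

Lemma val_mkpoint v : v != 0 -> val (mkpoint v) = <[v]>%VS.
Proof. by move=> v0; rewrite /mkpoint insubdK // -topredE /= dim_vline v0. Qed.

Lemma mkpoint_rep P : mkpoint (rep P) = P.
Proof. by apply: val_inj; rewrite val_mkpoint ?rep_neq0 // -val_rep. Qed.

Lemma rep_mkpoint v : v != 0 -> exists2 c, c != 0 & rep (mkpoint v) = c *: v.
Proof.
move=> v0; have /vlineP[c rE] : rep (mkpoint v) \in <[v]>%VS.
  by rewrite -val_mkpoint // memv_pick.
exists c => //; apply: contraNneq (rep_neq0 (mkpoint v)) => c0.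
by rewrite rE c0 scale0r.
Qed.

Lemma vline_scale c v : c != 0 -> <[c *: v]>%VS = <[v]>%VS.
Proof.
move=> c0; apply/eqP; rewrite eqEsubv -!memvE memvZ ?memv_line //=.
by apply/vlineP; exists c^-1; rewrite scalerA mulVf ?scale1r.
Qed.

Lemma mkpointZ c v : c != 0 -> mkpoint (c *: v) = mkpoint v.
Proof. by move=> c0; rewrite /mkpoint vline_scale. Qed.

Lemma mkpoint_sub v L : v != 0 -> (val (mkpoint v) <= L)%VS = (v \in L).
Proof. by move=> v0; rewrite val_mkpoint // memvE. Qed.

Lemma mem_rep P v : v \in val P -> exists c, v = c *: rep P.
Proof. by rewrite val_rep => /vlineP. Qed.

Definition had u v : 'rV[F]_n.+1 := \row_j (u 0 j * v 0 j).

Definition vpow v (r : nat) : 'rV[F]_n.+1 := \row_j (v 0 j ^+ r).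

Lemma hadZl c u v : had (c *: u) v = c *: had u v.
Proof. by apply/rowP=> j; rewrite !mxE mulrA. Qed.

Lemma hadZr c u v : had u (c *: v) = c *: had u v.
Proof. by apply/rowP=> j; rewrite !mxE mulrCA. Qed.

Lemma vpowZ c v r : vpow (c *: v) r = c ^+ r *: vpow v r.
Proof. by apply/rowP=> j; rewrite !mxE exprMn. Qed.

Lemma vpow_neq0 v r : v != 0 -> vpow v r != 0.
Proof.
case/rV0Pn=> j vj; apply/rV0Pn; exists j.
by rewrite mxE expf_neq0.
Qed.

Lemma hmul_mkpoint u v : u != 0 -> v != 0 ->
  hmul (mkpoint u) (mkpoint v) = mkpoint (had u v).
Proof.
rewrite /hmul => /rep_mkpoint[a a0 ->] /rep_mkpoint[b b0 ->].
rewrite -[mkpoint (had u v)](mkpointZ _ (mulf_neq0 a0 b0)).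
by congr mkpoint; apply/rowP=> j; rewrite !mxE mulrACA.
Qed.

Lemma ppow_mkpoint v r : v != 0 -> ppow (mkpoint v) r = mkpoint (vpow v r).
Proof.
move=> /rep_mkpoint[a a0 ra].
by rewrite /ppow -/(vpow _ _) ra vpowZ mkpointZ // expf_neq0.
Qed.

Lemma ppow1 P : ppow P 1 = P.
Proof.
rewrite -[RHS]mkpoint_rep /ppow; congr mkpoint.
by apply/rowP=> j; rewrite mxE expr1.
Qed.

Lemma hdefinedP P Q : hdefined P Q <-> had (rep P) (rep Q) != 0.
Proof.
split=> [[j [Pj Qj]] | /rV0Pn[j]].
  by apply/rV0Pn; exists j; rewrite mxE mulf_neq0.
by rewrite mxE mulf_eq0 negb_or => /andP[Pj Qj]; exists j.
Qed.

Lemma hdefined_mkpoint u v : u != 0 -> v != 0 -> had u v != 0 ->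
  hdefined (mkpoint u) (mkpoint v).
Proof.
move=> u0 v0 uv0; apply/hdefinedP.
have [a a0 ->] := rep_mkpoint u0; have [b b0 ->] := rep_mkpoint v0.
by rewrite hadZl hadZr !scaler_eq0 (negPf a0) (negPf b0).
Qed.

Lemma had_neq0 u v : had u v != 0 -> u != 0 /\ v != 0.
Proof.
case/rV0Pn=> j; rewrite mxE mulf_eq0 negb_or => /andP[uj vj].
by split; apply/rV0Pn; exists j.
Qed.

Definition lform (a : 'cV[F]_n.+1) : {mpoly F[n.+1]} := \sum_j a j 0 *: 'X_j.

Lemma lform_homog a : lform a \is 1.-homog.
Proof.
apply: rpred_sum => j _; apply: rpredZ.
by rewrite dhomogX /= mdeg1.
Qed.

Lemma meval_lform a v : (lform a).@[v 0] = (v *m a) 0 0.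
Proof.
rewrite /lform raddf_sum /= mxE; apply: eq_bigr => j _.
by rewrite mevalZ mevalXU mulrC.
Qed.

(** Some coordinate of [v - projv L v] is non-zero, and reading that coordinate of [u - projv L u]
    is a linear functional that kills [L]. *)
Lemma separating_form L v : v \notin L ->
  exists2 a : 'cV[F]_n.+1, (forall u, u \in L -> u *m a = 0) & v *m a != 0.
Proof.
move=> vL; have : v - projv L v != 0.
  by apply: contraNneq vL => /eqP; rewrite subr_eq0 => /eqP->; apply: memv_proj.
case/rV0Pn=> j vj.
pose f (u : 'rV[F]_n.+1) := (u - projv L u) 0 j.
have fE u : (u *m (\col_i f (delta_mx 0 i))) 0 0 = f u.
  rewrite {2}(row_sum_delta u) /f linear_sum -sumrB summxE mxE.
  by apply: eq_bigr => i _; rewrite linearZ /= -scalerBr !mxE.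
exists (\col_i f (delta_mx 0 i)) => [u uL|].
  by apply/matrixP=> a b; rewrite !ord1 fE /f projv_id // subrr !mxE.
by apply: contraNneq vj => /matrixP/(_ 0 0); rewrite fE mxE /f => ->.
Qed.

Lemma zariski_closed_linear L : zariski_closed [set P | (val P <= L)%VS].
Proof.
exists [set f | exists2 a, f = lform a & forall u, u \in L -> u *m a = 0].
  by move=> _ [a -> _]; exists 1%N; apply: lform_homog.
apply/seteqP; split=> P /=; rewrite sub_rep.
  by move=> PL _ [a -> aL]; rewrite /vanishes_at meval_lform aL // mxE.
move=> PL; apply: contraT => /separating_form[a aL Pa].
have := PL (lform a); rewrite /vanishes_at meval_lform.
move=> /(_ (ex_intro2 _ _ _ erefl aL)) Pa0.
by case/eqP: Pa; apply/matrixP=> i j; rewrite !ord1 Pa0 mxE.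
Qed.

(** The defined products already fill a linear space, which is closed, so the closure in [hprod]
    adds nothing. *)
Lemma hprod_linear (X Y : set (proj_point F n)) L :
  (forall S, (exists P Q, [/\ X P, Y Q, hdefined P Q & S = hmul P Q]) <->
             (val S <= L)%VS) ->
  hprod X Y = [set S | (val S <= L)%VS].
Proof.
move=> XY; apply/seteqP; split=> S /=.
  move=> SXY; apply: (SXY [set S | (val S <= L)%VS]).
  split; first exact: zariski_closed_linear.
  by move=> S' /XY.
by move=> /XY SL Z [_ XZ]; apply: XZ.
Qed.

End Points.

(** * Binary forms as univariate polynomials, and their zeros on the projective line *)

Section BinaryForms.
Variable F : fieldType.
Implicit Types (G H : {poly F}) (x y : F) (d e : nat).

(* The binary form of degree d with dehomogenization G; meaningful only when
   [size G <= d.+1], as higher coefficients are dropped. *)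
Definition form d G x y : F := \sum_(i < d.+1) G`_i * (x ^+ (d - i) * y ^+ i).

Lemma form_finite d G x y : (size G <= d.+1)%N -> x != 0 ->
  form d G x y = x ^+ d * G.[y / x].
Proof.
move=> sG x0; rewrite (horner_coef_wide _ sG) mulr_sumr.
apply: eq_bigr => i _; rewrite [RHS]mulrCA expr_div_n; congr (_ * _).
have id : (i <= d)%N by rewrite -ltnS.
by rewrite expfB_cond ?(negPf x0) // -mulrA [_^-1 * _]mulrC.
Qed.

Lemma form_infinite d G y : form d G 0 y = G`_d * y ^+ d.
Proof.
rewrite /form big_ord_recr /= subnn mul1r big1 ?add0r // => i _.
by rewrite expr0n subn_eq0 leqNgt ltn_ord mul0r mulr0.
Qed.

(** Multiplicativity at the point at infinity [x = 0]. The top coefficients are those of the formal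
    degrees [d] and [e], and may be zero. *)
Lemma coefM_top d e G H : (size G <= d.+1)%N -> (size H <= e.+1)%N ->
  (G * H)`_(d + e) = G`_d * H`_e.
Proof.
move=> sG sH; have dlt : (d < (d + e).+1)%N by rewrite ltnS leq_addr.
rewrite coefM (bigD1 (Ordinal dlt)) //= addKn big1 ?addr0 // => i.
rewrite -val_eqE /= neq_ltn => /orP[id|di].
  by rewrite [H`__]nth_default ?mulr0 // (leq_trans sH) // ltn_subRL ltn_add2r.
by rewrite nth_default ?mul0r // (leq_trans sG).
Qed.

Lemma size_form_mul d e G H : (size G <= d.+1)%N -> (size H <= e.+1)%N ->
  (size (G * H)%R <= (d + e).+1)%N.
Proof.
move=> sG sH; apply: leq_trans (size_polyMleq _ _) _.
have := leq_add sG sH; rewrite addSn addnS.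
by case: (size G + size H)%N.
Qed.

Lemma formM d e G H x y : (size G <= d.+1)%N -> (size H <= e.+1)%N ->
  form (d + e) (G * H) x y = form d G x y * form e H x y.
Proof.
move=> sG sH; have [->|x0] := eqVneq x 0.
  by rewrite !form_infinite coefM_top // exprD mulrACA.
by rewrite !form_finite ?size_form_mul // hornerM exprD mulrACA.
Qed.

Lemma formD d G H x y : form d (G + H) x y = form d G x y + form d H x y.
Proof.
by rewrite -big_split; apply: eq_bigr => i _; rewrite coefD mulrDl.
Qed.

Lemma formZ d a G x y : form d (a *: G) x y = a * form d G x y.
Proof. by rewrite mulr_sumr; apply: eq_bigr => i _; rewrite coefZ mulrA. Qed.

Lemma form0 d x y : form d 0 x y = 0.
Proof. by rewrite -(scale0r 0) formZ mul0r. Qed.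

Lemma formXn d i x y : (i <= d)%N -> form d 'X^i x y = x ^+ (d - i) * y ^+ i.
Proof.
rewrite -ltnS => id; rewrite /form (bigD1 (Ordinal id)) //= coefXn eqxx mul1r.
rewrite big1 ?addr0 // => j; rewrite -val_eqE /= => /negPf ji.
by rewrite coefXn ji mul0r.
Qed.

Definition lin (a b : F) : {poly F} := a%:P + b *: 'X.

Lemma size_lin a b : (size (lin a b) <= 2)%N.
Proof.
apply: leq_trans (size_polyD _ _) _; rewrite geq_max.
rewrite (leq_trans (size_polyC_leq1 _)) //.
by rewrite (leq_trans (size_scale_leq _ _)) // size_polyX.
Qed.

Lemma form_lin a b x y : form 1 (lin a b) x y = a * x + b * y.
Proof.
rewrite /form big_ord_recl big_ord1 /= !coefD !coefZ !coefC !coefX /=.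
by rewrite mulr0 mulr1 addr0 add0r !expr1 expr0 mulr1 mul1r.
Qed.

Lemma size_lin_exp n a b : (size (lin a b ^+ n)%R <= n.+1)%N.
Proof.
elim: n => [|n IH]; first by rewrite expr0 size_poly1.
by rewrite exprS; apply: (size_form_mul (size_lin a b) IH).
Qed.

Lemma form_lin_exp n a b x y : form n (lin a b ^+ n) x y = (a * x + b * y) ^+ n.
Proof.
elim: n => [|n IH].
  by rewrite /form big_ord1 coef1 /= !expr0 !mulr1.
by rewrite exprS -add1n formM ?size_lin ?size_lin_exp // IH form_lin exprS.
Qed.

Lemma size_prod_lin (I : finType) (A : pred I) (a b : I -> F) :
  (size (\prod_(i | A i) lin (a i) (b i))%R <= #|A|.+1)%N.
Proof.
apply: leq_trans (size_prod_leq _ _) _; rewrite leq_subLR addnS ltnS addnn -mul2n.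
by rewrite mulnC -sum_nat_const; apply: leq_sum => i _; apply: size_lin.
Qed.

(** A non-zero form of degree [d] has at most [d] zeros on the projective line. Zeros with
    [x j != 0] give distinct roots [y j / x j] of [G]; at most one index has [x j = 0], and a zero
    there lowers the degree of [G] below [d]. *)
Lemma form_eq0 (I : finType) d G (x y : I -> F) :
    (size G <= d.+1)%N -> (d < #|I|)%N ->
    (forall j k, j != k -> x j * y k != x k * y j) ->
    (forall j, form d G (x j) (y j) = 0) ->
  G = 0.
Proof.
move=> sG dI xy G0; apply: contraTeq isT => Gn0 /=.
pose A := [pred j | x j != 0].
have rootA : all (root G) [seq y j / x j | j <- enum A].
  apply/allP => _ /mapP[j xj ->]; rewrite mem_enum inE in xj.
  apply/rootP/eqP; have /eqP := G0 j.
  by rewrite form_finite // mulf_eq0 expf_eq0 (negPf xj) andbF.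
have uniqA : uniq [seq y j / x j | j <- enum A].
  rewrite map_inj_in_uniq ?enum_uniq // => j k; rewrite !mem_enum !inE => xj xk.
  move=> /eqP; rewrite eqr_div // => /eqP yx.
  by apply/eqP; apply: contraT => /xy; rewrite mulrC -yx mulrC eqxx.
have := max_poly_roots Gn0 rootA uniqA; rewrite size_map -cardE => ltA.
suff: (size G + #|predC A| <= d.+1)%N.
  rewrite leqNgt => /negP[]; apply: leq_ltn_trans dI _.
  by rewrite -(cardC A) ltn_add2r.
have [->|] := posnP #|predC A|; first by rewrite addn0.
case/card_gt0P=> j; rewrite !inE negbK => /eqP xj.
have -> : #|predC A| = 1%N.
  apply/eqP; rewrite -(card1 j); apply/eqP/eq_card => k; rewrite !inE negbK.
  apply/eqP/eqP => [xk|->//]; apply/eqP; apply: contraT => /xy.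
  by rewrite xj xk !mul0r eqxx.
rewrite addn1 ltnS leqNgt; apply/negP => sGd.
have sE : size G = d.+1 by apply/eqP; rewrite eqn_leq sG.
have := G0 j; rewrite xj form_infinite => /eqP; rewrite mulf_eq0.
rewrite -{1}[d]/(d.+1.-1) -sE -/(lead_coef G) lead_coef_eq0 (negPf Gn0) /=.
(* Now [x j] and [y j] both vanish, which contradicts [xy] for any second index. *)
rewrite expf_eq0 => /andP[d0 /eqP yj].
have : (1 < #|I|)%N by rewrite (leq_trans _ dI).
rewrite (cardD1 j) inE add1n ltnS => /card_gt0P[k]; rewrite !inE andbT => kj.
by have := xy _ _ kj; rewrite xj yj mul0r mulr0 eqxx.
Qed.

End BinaryForms.

Lemma split_form (F : closedFieldType) d (G : {poly F}) :
    (size G <= d.+2)%N ->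
  exists a b (H : {poly F}), (size H <= d.+1)%N /\ G = lin a b * H.
Proof.
rewrite leq_eqVlt => /orP[/eqP sG|sG]; last first.
  (* As a form of degree [d.+1], [G] vanishes at infinity; the linear factor split off is [x], whose
     dehomogenization is 1. *)
  by exists 1, 0, G; rewrite /lin scale0r addr0 mul1r.
have /closed_rootP[a] : size G != 1%N by rewrite sG.
case/factor_theorem=> H GE; exists (- a), 1, H; split.
  have H0 : H != 0 by apply: contra_eq_neq sG => H0; rewrite GE H0 mul0r size_poly0.
  by move: sG; rewrite GE size_Mmonic ?monicXsubC // size_XsubC addn2 => -[<-].
by rewrite GE mulrC /lin scale1r addrC polyCN.
Qed.

(** * Spaces of values of binary forms at the points [[p_j : r_j]] *)

Section LinearSystems.
Variables (F : fieldType) (n : nat) (p r : 'rV[F]_n.+1).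
Implicit Types (G H : {poly F}) (c v : 'rV[F]_n.+1).

Definition fvec d G : 'rV[F]_n.+1 := \row_j form d G (p 0 j) (r 0 j).

Lemma fvecD d G H : fvec d (G + H) = fvec d G + fvec d H.
Proof. by apply/rowP=> j; rewrite !mxE formD. Qed.

Lemma fvecZ d a G : fvec d (a *: G) = a *: fvec d G.
Proof. by apply/rowP=> j; rewrite !mxE formZ. Qed.

Lemma fvecM d e G H : (size G <= d.+1)%N -> (size H <= e.+1)%N ->
  fvec (d + e) (G * H) = had (fvec d G) (fvec e H).
Proof. by move=> sG sH; apply/rowP=> j; rewrite !mxE formM. Qed.

Lemma fvec_lin a b : fvec 1 (lin a b) = a *: p + b *: r.
Proof. by apply/rowP=> j; rewrite !mxE form_lin. Qed.

Lemma fvec_sum d G : fvec d G = \sum_(i < d.+1) G`_i *: fvec d 'X^i.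
Proof.
apply/rowP=> j; rewrite summxE mxE; apply: eq_bigr => i _.
by rewrite !mxE formXn // -ltnS.
Qed.

Definition lsys_basis c d := [tuple had c (fvec d 'X^i) | i < d.+1].

(** The factor [c] allows one construction to serve twice: the all-ones vector gives the Hadamard
    powers of the line, and a power of a point gives the osculating spaces. *)
Definition lsys c d : {vspace 'rV[F]_n.+1} := <<lsys_basis c d>>%VS.

Lemma had_sum_fvec c d G :
  had c (fvec d G) = \sum_(i < d.+1) G`_i *: (lsys_basis c d)`_i.
Proof.
rewrite fvec_sum; apply/rowP=> j; rewrite mxE !summxE mulr_sumr.
apply: eq_bigr => i _.
by rewrite -tnth_nth tnth_mktuple !mxE mulrCA.
Qed.

Lemma lsysP c d v :
  v \in lsys c d <-> exists2 G : {poly F}, (size G <= d.+1)%N & v = had c (fvec d G).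
Proof.
split=> [/coord_span vE|[G sG ->]].
  exists (\poly_(i < d.+1) coord (lsys_basis c d) (inord i) v).
    exact: size_poly.
  rewrite had_sum_fvec {1}vE; apply: eq_bigr => i _.
  by rewrite coef_poly ltn_ord inord_val.
rewrite had_sum_fvec; apply: memv_suml => i _; apply: memvZ; apply: memv_span.
by apply: mem_nth; rewrite size_tuple.
Qed.

Lemma dim_lsys c d :
    (forall G : {poly F}, (size G <= d.+1)%N -> had c (fvec d G) = 0 -> G = 0) ->
  \dim (lsys c d) = d.+1.
Proof.
move=> inj; suff /eqP -> : free (lsys_basis c d) by rewrite size_tuple.
apply/freeP => k k0 i.
have /inj : (size (\poly_(i < d.+1) k (inord i)) <= d.+1)%N by exact: size_poly.
rewrite had_sum_fvec => kP; rewrite -[k i](_ : (\poly_(i < d.+1) k (inord i))`_i = _).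
  rewrite kP ?coef0 // -[RHS]k0; apply: eq_bigr => l _.
  by rewrite coef_poly ltn_ord inord_val.
by rewrite coef_poly ltn_ord inord_val.
Qed.

End LinearSystems.

(** * Evaluation of multivariate polynomials at scalars and at univariate polynomials *)

Lemma meval_scale (F : fieldType) (n k : nat) (f : {mpoly F[n.+1]})
    (c : F) (v : 'rV[F]_n.+1) :
  f \is k.-homog -> f.@[(c *: v) 0] = c ^+ k * f.@[v 0].
Proof.
move/dhomogP=> fk; rewrite !mevalE mulr_sumr; apply: eq_big_seq => m mf.
rewrite mulrCA; congr (_ * _); rewrite -(fk m mf) /= mdegE -prodrXr -big_split /=.
by apply: eq_bigr => i _; rewrite mxE exprMn.
Qed.

Lemma horner_mmap (F : fieldType) (n : nat) (w : 'I_n -> {poly F})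
    (f : {mpoly F[n]}) t :
  (mmap polyC w f).[t] = f.@[fun j => (w j).[t]].
Proof.
rewrite mevalE /mmap horner_sum; apply: eq_bigr => m _.
rewrite hornerM hornerC horner_prod; congr (_ * _).
by apply: eq_bigr => i _; rewrite horner_exp.
Qed.

Lemma dvdp_mmapB (F : fieldType) (n : nat) (q : {poly F})
    (w u : 'I_n -> {poly F}) (f : {mpoly F[n]}) :
  (forall j, q %| w j - u j)%R -> (q %| mmap polyC w f - mmap polyC u f)%R.
Proof.
move=> wu; rewrite /mmap -sumrB; apply: (big_ind (fun g => q %| g)) => [|g h|m _].
- exact: dvdp0.
- exact: dvdp_add.
rewrite -mulrBr dvdp_mull //.
apply: (big_ind2 (fun g h => q %| g - h)) => [|g g' h h' gg' hh'|i _].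
- by rewrite subrr dvdp0.
- have -> : g * h - g' * h' = g * (h - h') + (g - g') * h' by ring.
  by apply: dvdp_add; [apply: dvdp_mull | apply: dvdp_mulr].
by rewrite subrXX dvdp_mulr.
Qed.

(** In characteristic zero the integers below [size q] are distinct, which is one root too many for
    a non-zero [q]. *)
Lemma poly_horner_eq0 (F : numFieldType) (q : {poly F}) :
  (forall t, q.[t] = 0) -> q = 0.
Proof.
move=> q0; apply: contraTeq isT => qn0 /=.
have := @max_poly_roots _ q [seq i%:R | i <- iota 0 (size q)] qn0.
rewrite size_map size_iota ltnn; apply.
  by apply/allP=> x _; apply/rootP.
by rewrite map_inj_uniq ?iota_uniq // => i j /eqP; rewrite eqr_nat => /eqP.
Qed.

(** The vector [v = 0] is covered because it lies on the line of any point of the subspace; [L != 0]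
    supplies such a point. *)
Lemma vanishing_linear (F : fieldType) n (L : {vspace 'rV[F]_n.+1}) f v :
  L != 0%VS -> vanishing_ideal [set P | (val P <= L)%VS] f -> v \in L ->
  f.@[v 0] = 0.
Proof.
move=> L0 fL vL; have [v0|v0] := eqVneq v 0.
  apply: (fL (mkpoint (vpick L))); last by rewrite v0 mem0v.
  by rewrite /= mkpoint_sub ?memv_pick // vpick0.
by apply: (fL (mkpoint v)); rewrite /= ?mkpoint_sub // val_mkpoint // memv_line.
Qed.

Lemma rV2_eq0 (F : fieldType) (v : 'rV[F]_2) : v 0 0 = 0 -> v 0 1 = 0 -> v = 0.
Proof.
move=> v0 v1; apply/rowP=> -[[|[|//]] lti]; rewrite mxE.
  by rewrite -[RHS]v0; congr (v 0 _); apply: val_inj.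
by rewrite -[RHS]v1; congr (v 0 _); apply: val_inj.
Qed.

(** * Hadamard powers of the line as linear systems *)

Section Line.
Variables (F : numClosedFieldType) (n : nat) (p r : 'rV[F]_n.+1).
Variable L : {vspace 'rV[F]_n.+1}.
Hypothesis LP : forall v, v \in L <-> exists a b, v = a *: p + b *: r.
Hypothesis pr : forall j k, j != k -> p 0 j * r 0 k != p 0 k * r 0 j.
Hypothesis n0 : (0 < n)%N.

Let ell : set (proj_point F n) := [set P | (val P <= L)%VS].
Let one : 'rV[F]_n.+1 := const_mx 1.

Lemma had1 (v : 'rV[F]_n.+1) : had one v = v.
Proof. by apply/rowP=> j; rewrite !mxE mul1r. Qed.

Lemma hadC (u v : 'rV[F]_n.+1) : had u v = had v u.
Proof. by apply/rowP=> j; rewrite !mxE mulrC. Qed.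

Lemma fvec_inj (G : {poly F}) : (size G <= n.+1)%N -> fvec p r n G = 0 -> G = 0.
Proof.
move=> sG /rowP G0; apply: (form_eq0 sG _ pr); first by rewrite card_ord.
by move=> j; have := G0 j; rewrite !mxE.
Qed.

(** Only evaluation in degree [n] is known to be injective, so the linear form is multiplied by the
    constant 1 read in degree [n.-1], that is, by [x^(n-1)]. *)
Lemma comb_eq0 a b : a *: p + b *: r = 0 -> a = 0 /\ b = 0.
Proof.
rewrite -fvec_lin => ab0.
have s1 : (size (lin a b * 1)%R <= n.+1)%N.
  by rewrite mulr1 (leq_trans (size_lin a b)).
have ab : lin a b = 0.
  rewrite -[LHS]mulr1; apply: fvec_inj => //.
  have s0 : (size (1%R : {poly F}) <= n.-1.+1)%N by rewrite size_poly1.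
  have := @fvecM F n p r _ _ _ _ (size_lin a b) s0; rewrite add1n prednK // ab0 => ->.
  by apply/rowP=> j; rewrite !mxE mul0r.
have : (lin a b)`_0 = 0 /\ (lin a b)`_1 = 0 by rewrite ab !coef0.
by rewrite !coefD !coefZ !coefC !coefX /= add0r mulr1 mulr0 addr0.
Qed.

Lemma lsys_one1 v : v \in L <-> v \in lsys p r one 1.
Proof.
rewrite lsysP LP; split=> [[a [b ->]]|[G sG ->]].
  by exists (lin a b); rewrite ?size_lin // had1 fvec_lin.
exists G`_0, G`_1; rewrite had1 -fvec_lin; congr fvec.
apply/polyP=> -[|[|i]]; rewrite !coefD !coefZ !coefC !coefX /=.
- by rewrite mulr0 addr0.
- by rewrite mulr1 add0r.
by rewrite mulr0 addr0 nth_default // (leq_trans sG).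
Qed.

Lemma hpow_lsys d : (0 < d)%N -> hpow ell d = [set S | (val S <= lsys p r one d)%VS].
Proof.
case: d => // d _; elim: d => [|d IH].
  by apply/seteqP; split=> S; rewrite /hpow /ell /= !sub_rep => /lsys_one1.
rewrite [LHS](_ : _ = hprod (hpow ell d.+1) ell) // IH.
apply: hprod_linear => S; split.
  move=> [A [B [/= + + /hdefinedP AB ->]]].
  rewrite /ell /= !sub_rep => /lsysP[G sG AE] /lsys_one1/lsysP[H sH BE].
  rewrite /hmul -/(had _ _) -sub_rep mkpoint_sub //; apply/lsysP.
  exists (G * H); last by rewrite -(addn1 d.+1) fvecM // AE BE !had1.
  by rewrite -(addn1 d.+1); apply: size_form_mul.
(* Conversely, a linear factor of the form of [S] is the point taken from the line. Since [rep S] is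
   non-zero, both factors are non-zero vectors and their product is defined. *)
rewrite sub_rep => /lsysP[G /split_form[a [b [H [sH ->]]]]]; rewrite had1 => SE.
have {}SE : rep S = had (fvec p r d.+1 H) (a *: p + b *: r).
  by rewrite SE -(add1n d.+1) fvecM ?size_lin // hadC fvec_lin.
have S0 := rep_neq0 S; rewrite SE in S0; have [A0 B0] := had_neq0 S0.
exists (mkpoint (fvec p r d.+1 H)), (mkpoint (a *: p + b *: r)); split.
- by rewrite /= mkpoint_sub //; apply/lsysP; exists H; rewrite ?had1.
- by rewrite /ell /= mkpoint_sub //; apply/LP; exists a, b.
- exact: hdefined_mkpoint.
by rewrite hmul_mkpoint // -SE mkpoint_rep.
Qed.

Lemma hprod_point_lsys c d : c != 0 -> (0 < d)%N ->
  hprod [set mkpoint c] (hpow ell d) = [set S | (val S <= lsys p r c d)%VS].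
Proof.
move=> c0 d0; rewrite hpow_lsys //; apply: hprod_linear => S; split.
  move=> [_ [B [/= -> + /hdefinedP cB ->]]].
  rewrite sub_rep => /lsysP[G sG BE]; rewrite had1 in BE.
  rewrite -[B in hmul _ B]mkpoint_rep hmul_mkpoint ?rep_neq0 //.
  have [a a0 aE] := rep_mkpoint c0.
  rewrite aE hadZl scaler_eq0 (negPf a0) /= in cB.
  by rewrite mkpoint_sub //; apply/lsysP; exists G; rewrite ?BE.
rewrite sub_rep => /lsysP[G sG SE].
have S0 := rep_neq0 S; rewrite SE in S0; have [_ G0] := had_neq0 S0.
exists (mkpoint c), (mkpoint (fvec p r d G)); split => //.
- by rewrite /= mkpoint_sub //; apply/lsysP; exists G; rewrite ?had1.
- exact: hdefined_mkpoint.
by rewrite hmul_mkpoint // -SE mkpoint_rep.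
Qed.

(** * The coordinate-wise power of the line as a rational normal curve *)

Definition rnc_mx : 'M[F]_n.+1 :=
  \matrix_(i, j) ('C(n, i)%:R * (p 0 j ^+ (n - i) * r 0 j ^+ i)).
Let M := rnc_mx.

Lemma mul_rnc_mx (v : 'rV[F]_n.+1) :
  v *m M = fvec p r n (\poly_(i < n.+1) (v 0 (inord i) * 'C(n, i)%:R)).
Proof.
apply/rowP=> j; rewrite !mxE; apply: eq_bigr => i _.
by rewrite coef_poly ltn_ord inord_val mxE mulrA.
Qed.

(** A vector in the kernel gives a form of degree [n] with zero values, hence zero coefficients; the
    binomial coefficients are invertible in characteristic zero. *)
Lemma rnc_mx_unit : M \in unitmx.
Proof.
rewrite -row_free_unit; apply: inj_row_free => v.
rewrite mul_rnc_mx => /(fvec_inj (size_poly _ _)) v0; apply/rowP=> i; rewrite mxE.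
have : (0 : {poly F})`_i = 0 by rewrite coef0.
rewrite -{1}v0 coef_poly ltn_ord inord_val.
move/eqP; rewrite mulf_eq0 pnatr_eq0 eqn0Ngt bin_gt0 -ltnS ltn_ord orbF.
by move/eqP.
Qed.

Definition vrow (s t : F) : 'rV[F]_n.+1 := \row_i (s ^+ (n - i) * t ^+ i).

(** This is the binomial theorem in each coordinate, and the reason for the binomial coefficients in
    [rnc_mx]. *)
Lemma vrow_mul s t : vrow s t *m M = vpow (s *: p + t *: r) n.
Proof.
apply/rowP=> j; rewrite !mxE exprDn; apply: eq_bigr => i _.
rewrite !mxE -[RHS]mulr_natl !exprMn.
by rewrite [LHS]mulrCA [X in _ * X]mulrACA.
Qed.

Lemma veronese_mkpoint (v : 'rV[F]_2) : v != 0 ->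
  proj_map M (veronese n (mkpoint v)) =
  mkpoint (vpow (v 0 0 *: p + v 0 1 *: r) n).
Proof.
move=> v0; have nz : vpow (v 0 0 *: p + v 0 1 *: r) n != 0.
  apply: vpow_neq0; apply: contraNneq v0 => /comb_eq0[v00 v01].
  by apply/eqP/rV2_eq0.
have vn0 : vrow (v 0 0) (v 0 1) != 0.
  by apply: contraNneq nz; rewrite -vrow_mul => ->; rewrite mul0mx.
have -> : veronese n (mkpoint v) = mkpoint (vrow (v 0 0) (v 0 1)).
  have [c c0 cE] := rep_mkpoint v0.
  rewrite -[RHS](mkpointZ _ (expf_neq0 n c0)) /veronese cE.
  congr mkpoint; apply/rowP=> i; rewrite !mxE.
  have -> : ord_max = 1 :> 'I_2 by apply: val_inj.
  rewrite !exprMn mulrACA -exprD subnK //; first by rewrite -ltnS.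
have [c c0 cE] := rep_mkpoint vn0.
by rewrite /proj_map cE -scalemxAl mkpointZ // vrow_mul.
Qed.

Lemma rnc_coord_pow : rational_normal_curve (coord_pow ell n).
Proof.
exists M; first exact: rnc_mx_unit.
apply/seteqP; split=> S.
  case=> Q; rewrite /ell /= sub_rep => /LP[a [b QE]] <-.
  pose v : 'rV[F]_2 := \row_i (if i == 0 then a else b).
  have v0 : v != 0.
    apply: contraNneq (rep_neq0 Q) => v0.
    have a0 : a = 0 by have /rowP/(_ 0) := v0; rewrite !mxE.
    have b0 : b = 0 by have /rowP/(_ 1) := v0; rewrite !mxE.
    by rewrite QE a0 b0 !scale0r addr0.
  exists (veronese n (mkpoint v)); first by exists (mkpoint v).
  by rewrite veronese_mkpoint // !mxE /= -QE.
case=> _ [K _ <-] <-; rewrite -(mkpoint_rep K) veronese_mkpoint ?rep_neq0 //.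
set q := _ + _; have q0 : q != 0.
  apply: contraNneq (rep_neq0 K) => /comb_eq0[k0 k1].
  by apply/eqP/rV2_eq0.
exists (mkpoint q); last exact: ppow_mkpoint.
by rewrite /ell /= mkpoint_sub //; apply/LP; exists (rep K 0 0), (rep K 0 1).
Qed.

(** * Osculating spaces at the point of parameter [t = 0] *)

Let X := coord_pow ell n.
Let P := mkpoint (vpow p n).

Lemma p_neq0 : p != 0.
Proof.
apply/negP=> /eqP p0; have [] := @comb_eq0 1 0.
  by rewrite p0 scaler0 scale0r addr0.
by move/eqP; rewrite oner_eq0.
Qed.

Lemma pencil_neq0 t : p + t *: r != 0.
Proof.
apply/negP=> /eqP pt; have [] := @comb_eq0 1 t.
  by rewrite scale1r.
by move/eqP; rewrite oner_eq0.
Qed.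

(* The homogeneous coordinates of (p + t r)^{o n}, as polynomials in t. *)
Definition curve_poly (j : 'I_n.+1) : {poly F} :=
  \poly_(i < n.+1) M (inord i) j.

Definition pullback (f : {mpoly F[n.+1]}) : {poly F} := mmap polyC curve_poly f.

Lemma pullbackD f g : pullback (f + g) = pullback f + pullback g.
Proof. exact: rmorphD. Qed.

Lemma pullbackM f g : pullback (f * g) = pullback f * pullback g.
Proof. exact: rmorphM. Qed.

Lemma pullback_lincomb m (c : 'I_m -> F) (f : 'I_m -> {mpoly F[n.+1]}) :
  pullback (\sum_i c i *: f i) = \sum_i c i *: pullback (f i).
Proof.
rewrite /pullback raddf_sum /=; apply: eq_bigr => i _.
by rewrite mmapZ mul_polyC.
Qed.

Lemma curve_polyE t j : (curve_poly j).[t] = vpow (p + t *: r) n 0 j.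
Proof.
rewrite -[p in RHS]scale1r -vrow_mul mxE horner_poly; apply: eq_bigr => i _.
by rewrite inord_val !mxE expr1n mul1r mulrC.
Qed.

Lemma pullbackE f t : (pullback f).[t] = f.@[vpow (p + t *: r) n 0].
Proof. by rewrite horner_mmap; apply: meval_eq => j; rewrite curve_polyE. Qed.

Lemma pullback_curve a : vanishing_ideal X a -> pullback a = 0.
Proof.
move=> aX; apply: poly_horner_eq0 => t; rewrite pullbackE.
have pt := pencil_neq0 t.
apply: (aX (mkpoint (vpow (p + t *: r) n))).
  exists (mkpoint (p + t *: r)); last exact: ppow_mkpoint.
  rewrite /ell /= mkpoint_sub //; apply/LP; exists 1, t; by rewrite scale1r.
by rewrite val_mkpoint ?memv_line ?vpow_neq0.
Qed.

Definition osc d := lsys p r (vpow p (n - d)) d.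

Lemma row_rnc_mx (i : 'I_n.+1) d : (i <= d)%N -> (d <= n)%N ->
  row i M = 'C(n, i)%:R *: had (vpow p (n - d)) (fvec p r d 'X^i).
Proof.
move=> id dn; apply/rowP=> j; rewrite !mxE formXn //; congr (_ * _).
by rewrite mulrA -exprD addnBA // subnK.
Qed.

(** The coordinates of [p] are the values of the form [x], and multiplying a form by [x^(n-d)] does
    not change its dehomogenization. Thus [osc d] consists of the forms of degree [n] given by
    polynomials of size at most [d.+1]. *)
Lemma had_fvec_inj d (G : {poly F}) : (d <= n)%N -> (size G <= d.+1)%N ->
  had (vpow p (n - d)) (fvec p r d G) = fvec p r n G.
Proof.
move=> dn sG; rewrite [RHS]fvec_sum (bigID (fun i : 'I_n.+1 => (i <= d)%N)) /=.
rewrite [X in _ + X]big1 ?addr0 => [|i]; last first.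
  by rewrite -ltnNge => di; rewrite nth_default ?scale0r // (leq_trans sG).
have dn' : (d.+1 <= n.+1)%N by [].
rewrite (fvec_sum p r d G) (big_ord_widen _ (fun i => G`_i *: fvec p r d 'X^i) dn').
apply/rowP=> j; rewrite mxE !summxE mulr_sumr; apply: eq_big => // i.
rewrite ltnS => id; rewrite !mxE !formXn //; last by rewrite -ltnS.
rewrite mulrCA; congr (_ * _).
by rewrite mulrA -exprD addnBA // subnK.
Qed.

Lemma dim_osc d : (d <= n)%N -> \dim (osc d) = d.+1.
Proof.
move=> dn; apply: dim_lsys => G sG; rewrite had_fvec_inj // => /fvec_inj; apply.
exact: leq_trans sG _.
Qed.

Lemma mem_osc_row (i : 'I_n.+1) d : (i <= d)%N -> (d <= n)%N -> row i M \in osc d.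
Proof.
move=> id dn; rewrite (row_rnc_mx id dn) memvZ //; apply/lsysP; exists 'X^i => //.
by rewrite size_polyXn.
Qed.

(** Up to the invertible factors ['C(n, i)], the rows of index at most [d] are the generators of
    [osc d]. *)
Lemma osc_sub_rows d (L' : {vspace 'rV[F]_n.+1}) : (d <= n)%N ->
  (forall i : 'I_n.+1, (i <= d)%N -> row i M \in L') -> (osc d <= L')%VS.
Proof.
move=> dn rL; apply/span_subvP => _ /tnthP[i ->]; rewrite tnth_mktuple.
have id : (i <= d)%N by rewrite -ltnS.
have iE : (inord i : 'I_n.+1) = i :> nat by rewrite inordK // ltnS (leq_trans id).
have := rL (inord i); rewrite (@row_rnc_mx _ d) ?iE // => /(_ id).
move/(memvZ ('C(n, i)%:R^-1)).
rewrite scalerA mulVf ?scale1r //.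
by rewrite pnatr_eq0 -lt0n bin_gt0 (leq_trans id).
Qed.

(* The truncation u of the parametrization modulo t^(d+1) lies in the osculating
   space, where b vanishes identically. *)
Lemma pullback_osc d b : (d <= n)%N ->
  vanishing_ideal [set S | (val S <= osc d)%VS] b -> ('X^(d.+1) %| pullback b)%R.
Proof.
move=> dn bT.
pose u j : {poly F} := \poly_(i < d.+1) M (inord i) j.
have u0 : mmap polyC u b = 0.
  apply: poly_horner_eq0 => t; rewrite horner_mmap.
  pose v : 'rV[F]_n.+1 := \sum_(i < d.+1) t ^+ i *: row (inord i) M.
  rewrite (@meval_eq _ _ _ (v 0)) => [|j].
    apply: vanishing_linear bT _; first by rewrite -dimv_eq0 dim_osc.
    apply: rpred_sum => i _; apply: rpredZ; apply: mem_osc_row => //.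
    by rewrite -ltnS inordK // (leq_trans (ltn_ord i)).
  rewrite summxE horner_poly; apply: eq_bigr => i _.
  by rewrite !mxE mulrC.
rewrite -[pullback b]subr0 -u0; apply: dvdp_mmapB => j.
have -> : curve_poly j - u j = 'X^(d.+1) * \poly_(i < n - d) M (inord (i + d.+1)) j.
  apply/polyP=> i; rewrite coefB !coef_poly mulrC coefMXn coef_poly.
  case: (ltnP i d.+1) => [id|di]; first by rewrite (leq_trans id) // subrr.
  rewrite subr0 subnK //; congr (if _ then _ else _).
  by rewrite ltn_subLR // addSn subnKC.
exact: dvdp_mulIl.
Qed.

(** Coordinates in which the curve becomes the standard one, [t |-> (1, t, ..., t^n)]. *)
Definition zform (i : 'I_n.+1) : {mpoly F[n.+1]} := lform (col i (invmx M)).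

Lemma meval_zform i (v : 'rV[F]_n.+1) : (zform i).@[(v *m M) 0] = v 0 i.
Proof.
by rewrite meval_lform colE mulmxA mulmxK ?rnc_mx_unit // -colE mxE.
Qed.

Lemma pullback_zform i : pullback (zform i) = 'X^i.
Proof.
apply/eqP; rewrite -subr_eq0; apply/eqP; apply: poly_horner_eq0 => t.
rewrite hornerD hornerN hornerXn pullbackE -[p]scale1r -vrow_mul meval_zform.
by rewrite mxE expr1n mul1r subrr.
Qed.

Lemma vanishes_at_pullback k f : f \is k.-homog ->
  ~ vanishes_at f P <-> (pullback f).[0] != 0.
Proof.
move=> fk; rewrite /vanishes_at pullbackE scale0r addr0.
have [c c0 ->] := rep_mkpoint (vpow_neq0 n p_neq0).
rewrite (meval_scale _ _ fk); split=> [/eqP|].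
  by rewrite mulf_eq0 expf_eq0 (negPf c0) andbF.
by move=> f0; apply/eqP; rewrite mulf_eq0 expf_eq0 (negPf c0) andbF.
Qed.

(** The forms [zform 0], ..., [zform d] pull back to [1, t, ..., t^d], which are independent modulo
    [t^(d+1)], while the local ideal pulls back into the multiples of [t^(d+1)]. *)
Lemma osc_mult_ge d : (d <= n)%N ->
  meets_with_mult_ge X [set S | (val S <= osc d)%VS] P d.+1.
Proof.
move=> dn; exists 1%N, (fun i => zform (inord i)); split.
  by move=> i; apply: lform_homog.
move=> c [e [h [a [b [he hP aX bT hf]]]]] i.
have := congr1 pullback hf; rewrite pullbackM pullbackD (pullback_curve aX) add0r.
move=> hfE.
have := pullback_osc dn bT; rewrite -hfE.
(* The denominator [h] does not vanish at [t = 0], so it can be cancelled from the divisibility. *)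
have h0 : coprimep 'X^(d.+1) (pullback h).
  rewrite coprimep_expl // -['X]subr0 -[0]polyC0 coprimep_sym coprimep_XsubC.
  by apply/(vanishes_at_pullback he).
rewrite Gauss_dvdpr // => /dvdp_leq.
have -> : pullback (\sum_(i < d.+1) c i *: zform (inord i)) =
          \poly_(i < d.+1) c (inord i).
  rewrite pullback_lincomb poly_def; apply: eq_bigr => j _.
  rewrite pullback_zform inord_val.
  by rewrite inordK // ltnS (leq_trans _ dn) // -ltnS.
move=> le_size.
have c0 : \poly_(i < d.+1) c (inord i) = 0 :> {poly F}.
  apply: contraTeq isT => /le_size; rewrite size_polyXn => /leq_trans.
  by move=> /(_ _ (size_poly _ _)); rewrite ltnn.
have : (0 : {poly F})`_i = 0 by rewrite coef0.
by rewrite -{1}c0 coef_poly ltn_ord inord_val.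
Qed.

(* The linear forms zform 0 and zform (inord 1) restrict to x and t x at the point
   x *: (p + t r)^{o n} of the cone over the curve, and zform 0 vanishes at its
   remaining points.  So lift_form N G has value x^N G(t) on the cone, and 0 at
   infinity if [size G <= N]. *)
Definition lift_form N (G : {poly F}) : {mpoly F[n.+1]} :=
  \sum_(i < N.+1) G`_i *: (zform 0 ^+ (N - i) * zform (inord 1) ^+ i).

Lemma lift_form_homog N G : lift_form N G \is N.-homog.
Proof.
apply: rpred_sum => i _; apply: rpredZ.
have iN : (i <= N)%N by rewrite -ltnS.
have := dhomogM (dhomogMn (N - i) (lform_homog (col 0 (invmx M))))
                (dhomogMn i (lform_homog (col (inord 1) (invmx M)))).
by rewrite !mul1n subnK.
Qed.

Lemma meval_lift_form N G (v : 'rV[F]_n.+1) :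
  (lift_form N G).@[v 0] = form N G (zform 0).@[v 0] (zform (inord 1)).@[v 0].
Proof.
rewrite /lift_form raddf_sum /=; apply: eq_bigr => i _.
by rewrite mevalZ rmorphM !rmorphXn.
Qed.

Lemma zform0_curve x t : (zform 0).@[(x *: vpow (p + t *: r) n) 0] = x.
Proof.
rewrite -[p]scale1r -vrow_mul scalemxAl meval_zform.
by rewrite !mxE expr1n !mul1r expr0 mulr1.
Qed.

Lemma zform1_curve x t :
  (zform (inord 1)).@[(x *: vpow (p + t *: r) n) 0] = t * x.
Proof.
rewrite -[p]scale1r -vrow_mul scalemxAl meval_zform.
by rewrite !mxE expr1n !mul1r inordK ?ltnS // expr1 mulrC.
Qed.

Lemma lift_form_curve N (G : {poly F}) x t : x != 0 -> (size G <= N.+1)%N ->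
  (lift_form N G).@[(x *: vpow (p + t *: r) n) 0] = x ^+ N * G.[t].
Proof.
move=> x0 sG; rewrite meval_lift_form zform0_curve zform1_curve.
by rewrite form_finite // mulfK.
Qed.

Lemma lift_form_infinity N (G : {poly F}) (v : 'rV[F]_n.+1) :
  (zform 0).@[v 0] = 0 -> (size G <= N)%N -> (lift_form N G).@[v 0] = 0.
Proof.
move=> v0 sG; rewrite meval_lift_form v0 form_infinite.
by rewrite nth_default ?mul0r.
Qed.

(** [vanishing_ideal] tests every vector of the cone. Those not above a finite parameter, namely the
    zero vector and the multiples of the point with [a = 0], are caught by [zform 0]. *)
Lemma curve_point S v : X S -> v \in val S ->
  (zform 0).@[v 0] = 0 \/
  exists x t, x != 0 /\ v = x *: vpow (p + t *: r) n.
Proof.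
case=> Q QL <- vS; move: QL; rewrite /ell /= sub_rep => /LP[a [b QE]].
have {vS} [s ->] : exists s, v = s *: vpow (a *: p + b *: r) n.
  have [s ->] := mem_rep vS; rewrite -QE.
  have [c c0 ->] := rep_mkpoint (vpow_neq0 n (rep_neq0 Q)).
  by exists (s * c); rewrite scalerA.
have [a0|a0] := eqVneq a 0.
  left; rewrite -vrow_mul scalemxAl meval_zform !mxE a0 subn0.
  by rewrite expr0n gtn_eqF // mul0r mulr0.
have [s0|s0] := eqVneq s 0.
  by left; rewrite -vrow_mul scalemxAl meval_zform !mxE s0 mul0r.
right; exists (s * a ^+ n), (b / a); split.
  by rewrite mulf_neq0 // expf_neq0.
rewrite -scalerA -vpowZ scalerDr scalerA; congr (_ *: vpow (_ + _ *: _) n).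
by rewrite mulrCA divff // mulr1.
Qed.

Lemma pullback_lform a :
  pullback (lform a) = \poly_(i < n.+1) (M *m a) (inord i) 0.
Proof.
apply/eqP; rewrite -subr_eq0; apply/eqP; apply: poly_horner_eq0 => t.
rewrite hornerD hornerN pullbackE -[p]scale1r -vrow_mul meval_lform -mulmxA.
rewrite [in X in X - _]mxE horner_poly -sumrB big1 // => i _.
by rewrite inord_val mxE expr1n mul1r mulrC subrr.
Qed.

(* If T' does not contain the osculating space, some linear form lam vanishing
   on T' restricts to mu t^e with mu(0) != 0 and e <= d.  Among d+1 forms of the
   same degree some combination f0 restricts to g t^e; then mu f0 and g lam,
   lifted to forms of the same degree, agree on the curve, so f0 lies in the
   local ideal. *)
Lemma osc_unique d T' : (d <= n)%N -> linear_subspace d T' ->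
  meets_with_mult_ge X T' P d.+1 -> T' = [set S | (val S <= osc d)%VS].
Proof.
move=> dn [L' dL' ->] [k [f [fk indep]]].
suff sub : (osc d <= L')%VS.
  suff -> : osc d = L' by [].
  by apply/eqP; rewrite eqEdim sub dL' dim_osc /=.
apply: osc_sub_rows => // i id; apply: contraT => /separating_form[a aL' ai].
pose lam := lform a.
(* The coefficient of [t^i] in the pullback of [lam] is its value at row [i] of [M], so the order
   [e] at [t = 0] is at most [i <= d]. *)
have lam_i : (pullback lam)`_i != 0.
  rewrite pullback_lform coef_poly ltn_ord inord_val.
  apply: contraNneq ai => ai0; apply/eqP/matrixP=> j l.
  by rewrite !ord1 -row_mul mxE ai0 mxE.
have lam0 : pullback lam != 0 by apply: contraNneq lam_i => ->; rewrite coef0.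
have [e [mu]] := multiplicity_XsubC (pullback lam) 0.
rewrite lam0 /= subr0 => mu0 lamE.
have ei : (e <= i)%N.
  by rewrite leqNgt; apply: contra lam_i => ie; rewrite lamE coefMXn ie.
(* [A] holds the coefficients below [t^e]. It has more rows than columns, so a non-trivial
   combination of the [f j] kills them all. *)
pose A := \matrix_(j < d.+1, l < e) (pullback (f j))`_l.
have : kermx A != 0.
  rewrite kermx_eq0 /row_free; apply: contraTneq (rank_leq_col A) => ->.
  by rewrite -ltnNge ltnS (leq_trans ei).
case/rowV0Pn=> c /sub_kermxP cA /rV0Pn[j cj].
pose f0 := \sum_j c 0 j *: f j.
have [g gE] : exists g, pullback f0 = g * 'X^e.
  exists (drop_poly e (pullback f0)).
  rewrite -[LHS](poly_take_drop e) [X in X + _](_ : _ = 0) ?add0r //.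
  apply/polyP=> l; rewrite coef_take_poly coef0; case: ifP => // le.
  have := congr1 (fun B : 'rV_e => B 0 (Ordinal le)) cA; rewrite !mxE => cAl.
  rewrite -[RHS]cAl pullback_lincomb coef_sum; apply: eq_bigr => m _.
  by rewrite coefZ !mxE.
case/eqP: cj; apply: (indep (c 0)); rewrite -/f0.
have f0k : f0 \is k.-homog by apply: rpred_sum => l _; apply: rpredZ.
(* The equality [Q + k = N + 1] makes the two products homogeneous of the same degree; [Q] and [N]
   are also large enough for the lifts of [mu] and [g] to vanish at infinity. *)
pose N := (size mu + size g + k)%N; pose Q := (size mu + size g).+1.
have sQ : (size mu <= Q)%N by rewrite /Q leqW // leq_addr.
have sN : (size g <= N)%N by rewrite /N addnAC leq_addl.
have QN : (Q + k = N.+1)%N by [].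
exists Q, (lift_form Q mu), (lift_form Q mu * f0 - lam * lift_form N g),
  (lam * lift_form N g).
split.
- exact: lift_form_homog.
- apply/(vanishes_at_pullback (lift_form_homog Q mu)).
  rewrite pullbackE -[vpow _ _]scale1r lift_form_curve ?oner_eq0 ?(leqW sQ) //.
  by rewrite expr1n mul1r.
- move=> S XS v vS; rewrite mevalB !mevalM.
  have [z0|[x [t [x0 ->]]]] := curve_point XS vS.
    by rewrite !lift_form_infinity ?mul0r ?mulr0 ?subrr.
  rewrite !lift_form_curve ?(leqW sQ) ?(leqW sN) //.
  rewrite (meval_scale _ _ f0k) (meval_scale _ _ (lform_homog a)) expr1.
  rewrite -!pullbackE lamE gE !hornerM hornerXn.
  have xE : x ^+ Q * x ^+ k = x * x ^+ N by rewrite -exprD QN exprS.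
  transitivity ((x ^+ Q * x ^+ k - x * x ^+ N) * (mu.[t] * g.[t] * t ^+ e)).
    by ring.
  by rewrite xE subrr mul0r.
- move=> S /= SL v vS; rewrite mevalM meval_lform aL' ?mxE ?mul0r //.
  exact: (subvP SL).
by rewrite subrK.
Qed.

Lemma osculating_osc d : (d <= n)%N ->
  osculating_space d X P [set S | (val S <= osc d)%VS].
Proof.
move=> dn; split.
- by exists (osc d); rewrite ?dim_osc.
- exact: osc_mult_ge.
- by move=> T'; apply: osc_unique.
Qed.

(** A power [(a x + b y)^n] has coefficient [b^n] at [y^n], whereas forms in [osc d] have none there
    when [d < n]. Hence [b = 0], and the point comes from [p]. *)
Lemma osc_meet d : (d < n)%N -> [set S | (val S <= osc d)%VS] `&` X = [set P].
Proof.
move=> dn; apply/seteqP; split=> S /=; last first.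
  move=> ->; split.
    rewrite /P mkpoint_sub ?vpow_neq0 ?p_neq0 //.
    rewrite (_ : vpow p n = row 0 M) ?mem_osc_row // ?(ltnW dn) //.
    by apply/rowP=> j; rewrite !mxE bin0 subn0 expr0 mulr1 mul1r.
  exists (mkpoint p); last by rewrite ppow_mkpoint ?p_neq0.
  rewrite /ell /= mkpoint_sub ?p_neq0 //; apply/LP; exists 1, 0.
  by rewrite scale1r scale0r addr0.
case=> + [Q + SE]; rewrite -SE /ell /= !sub_rep => + /LP[a [b QE]].
have q0 : vpow (rep Q) n != 0 by rewrite vpow_neq0 ?rep_neq0.
rewrite -{1}(mkpoint_rep Q) ppow_mkpoint ?rep_neq0 // -sub_rep mkpoint_sub //.
case/lsysP=> G sG; rewrite had_fvec_inj ?(ltnW dn) // => GE.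
have slin : (size (lin a b ^+ n)%R <= n.+1)%N by apply: size_lin_exp.
have : lin a b ^+ n - G = 0.
  apply: fvec_inj.
    rewrite (leq_trans (size_polyD _ _)) // size_polyN geq_max slin.
    by rewrite (leq_trans sG) // ltnS ltnW.
  rewrite fvecD -scaleN1r fvecZ scaleN1r -GE QE.
  apply/rowP=> j; rewrite !mxE form_lin_exp; apply/eqP.
  by rewrite subr_eq0 mulrC [b * _]mulrC.
move/eqP; rewrite subr_eq0 => /eqP linE.
have b0 : b = 0.
  have := form_lin_exp n a b 0 1; rewrite linE form_infinite nth_default.
    rewrite mul0r mulr0 add0r mulr1 => /esym/eqP.
    by rewrite expf_eq0 n0 => /eqP.
  exact: leq_trans sG dn.
have a0 : a != 0.
  apply: contraNneq (rep_neq0 Q) => a0.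
  by rewrite QE a0 b0 !scale0r addr0.
rewrite /P -ppow_mkpoint ?p_neq0 // -(mkpointZ p a0) -[in RHS](addr0 (a *: p)).
by rewrite -(scale0r r) -b0 -QE mkpoint_rep.
Qed.

(** * Products of [n] points of the line as intersections of hyperplanes *)

Lemma form_prod_lin m (a b : 'I_m -> F) x y :
  form m (\prod_i lin (a i) (b i)) x y = \prod_i (a i * x + b i * y).
Proof.
elim: m => [|m IH] in a b *.
  by rewrite !big_ord0 /form big_ord1 coef1 /= !expr0 !mulr1.
rewrite !big_ord_recl -IH -form_lin -formM ?size_lin ?add1n //.
by have := size_prod_lin predT (a \o lift ord0) (b \o lift ord0); rewrite card_ord.
Qed.

(** A common non-zero coordinate keeps every partial product non-zero, so the default value of
    [mkpoint] never occurs. *)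
Lemma big_hmul m (Q : 'I_m -> proj_point F n) j :
  (forall i, rep (Q i) 0 j != 0) ->
  \big[@hmul F n/@hone F n]_(i < m) Q i =
  mkpoint (\row_l \prod_(i < m) rep (Q i) 0 l).
Proof.
elim: m => [|m IH] in Q * => Qj.
  rewrite big_ord0; apply: val_inj; rewrite /= val_mkpoint.
    by congr <[_]>%VS; apply/rowP=> l; rewrite !mxE big_ord0.
  by apply/rV0Pn; exists j; rewrite mxE big_ord0 oner_eq0.
rewrite big_ord_recl (IH (Q \o lift ord0)) //; last by move=> i; apply: Qj.
rewrite -[Q ord0 in LHS]mkpoint_rep hmul_mkpoint ?rep_neq0 //.
  by congr mkpoint; apply/rowP=> l; rewrite !mxE big_ord_recl.
apply/rV0Pn; exists j; rewrite mxE; apply/prodf_neq0 => i _; exact: Qj.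
Qed.

Lemma product_of_points (Q : 'I_n -> proj_point F n) :
    (1 < n)%N -> injective Q -> (forall i, ell (Q i)) ->
  (exists j, forall i, rep (Q i) 0 j != 0) /\
  [set \big[@hmul F n/@hone F n]_(i < n) Q i] =
  \bigcap_(i in [set: 'I_n]) hprod [set Q i] (hpow ell (n - 1)%N).
Proof.
move=> n1 injQ Qell.
have /fin_all_exists[a /fin_all_exists[b QE]] : forall i, exists a b,
    rep (Q i) = a *: p + b *: r.
  by move=> i; apply/LP; rewrite -sub_rep; apply: Qell.
have prop_inj i k c : rep (Q k) = c *: rep (Q i) -> i = k.
  move=> ck; have c0 : c != 0.
    by apply: contraNneq (rep_neq0 (Q k)) => c0; rewrite ck c0 scale0r.
  by apply: injQ; rewrite -(mkpoint_rep (Q k)) ck mkpointZ // mkpoint_rep.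
(* Distinct points have non-proportional linear forms. *)
have ab i k : i != k -> a i * b k != a k * b i.
  apply: contraNneq => abik; apply/eqP; have [a0|a0] := eqVneq (a i) 0.
    have b0 : b i != 0.
      apply: contraNneq (rep_neq0 (Q i)) => b0.
      by rewrite QE a0 b0 !scale0r addr0.
    have ak : a k = 0.
      by apply/eqP; move/esym/eqP: abik; rewrite a0 mul0r mulf_eq0 (negPf b0) orbF.
    apply: (prop_inj _ _ (b k / b i)).
    by rewrite !QE a0 ak !scale0r !add0r scalerA divfK.
  apply: (prop_inj _ _ (a k / a i)).
  rewrite !QE scalerDr !scalerA divfK //; congr (_ + _ *: _).
  by rewrite mulrAC -abik mulrAC divff ?mul1r.
pose G0 := \prod_i lin (a i) (b i).
have sG0 : (size G0 <= n.+1)%N.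
  by have := size_prod_lin predT a b; rewrite card_ord.
have G0E j : fvec p r n G0 0 j = \prod_i rep (Q i) 0 j.
  rewrite mxE form_prod_lin; apply: eq_bigr => i _.
  by rewrite QE !mxE.
have fG0 : fvec p r n G0 != 0.
  apply/negP=> /eqP/(fvec_inj sG0)/eqP; apply/negP/prodf_neq0 => i _.
  apply: contraNneq (rep_neq0 (Q i)) => lin0; rewrite QE -fvec_lin lin0.
  by apply/eqP/rowP=> j; rewrite !mxE form0.
(* The form [G0] is non-zero and evaluation is injective in degree [n]; a coordinate where its value
   is non-zero is one where no [Q i] vanishes, so the product of points is defined. *)
have [j0 Gj0] : exists j, fvec p r n G0 0 j != 0 by apply/rV0Pn.
have Qj0 i : rep (Q i) 0 j0 != 0.
  by move: Gj0; rewrite G0E => /prodf_neq0; apply.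
split; first by exists j0.
have nE : (n - 1).+1 = n by rewrite subn1 prednK.
have hprodE i : hprod [set Q i] (hpow ell (n - 1)) =
    [set S | (val S <= lsys p r (rep (Q i)) (n - 1))%VS].
  rewrite -{1}(mkpoint_rep (Q i)) hprod_point_lsys ?rep_neq0 //.
  by rewrite subn_gt0.
have had_lin i (H : {poly F}) : (size H <= n)%N ->
    had (rep (Q i)) (fvec p r (n - 1) H) = fvec p r n (lin (a i) (b i) * H).
  move=> sH; have sH' : (size H <= (n - 1).+1)%N by rewrite nE.
  have := @fvecM F n p r _ _ _ _ (size_lin (a i) (b i)) sH'.
  by rewrite add1n nE fvec_lin -QE.
have size_lin_mul i (H : {poly F}) : (size H <= n)%N ->
    (size (lin (a i) (b i) * H)%R <= n.+1)%N.
  move=> sH; have sH' : (size H <= (n - 1).+1)%N by rewrite nE.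
  by have := size_form_mul (size_lin (a i) (b i)) sH'; rewrite add1n nE.
rewrite (big_hmul Qj0) (_ : \row_l _ = fvec p r n G0); last first.
  by apply/rowP=> j; rewrite G0E mxE.
apply/seteqP; split=> S /=.
  move=> -> i _; rewrite hprodE /= mkpoint_sub //; apply/lsysP.
  have sH : (size (\prod_(k | k != i) lin (a k) (b k))%R <= n)%N.
    by have := size_prod_lin (predC1 i) a b; rewrite cardC1 card_ord -subn1 nE.
  exists (\prod_(k | k != i) lin (a k) (b k)); first by rewrite nE.
  by rewrite had_lin // /G0 (bigD1 i).
move=> SQ.
have /fin_all_exists[H HE] : forall i, exists H : {poly F},
    (size H <= n)%N /\ rep S = fvec p r n (lin (a i) (b i) * H).
  move=> i; have := SQ i I; rewrite hprodE /= sub_rep => /lsysP[H sH ->].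
  by rewrite nE in sH; exists H; rewrite had_lin.
(* By injectivity of evaluation, the forms found for the different [i] are all the same [G], which
   is therefore divisible by each linear form. *)
pose i0 := Ordinal n0; pose G := lin (a i0) (b i0) * H i0.
have sG : (size G <= n.+1)%N by apply: size_lin_mul; case: (HE i0).
have SE : rep S = fvec p r n G by case: (HE i0).
have GE i : G = lin (a i) (b i) * H i.
  have [sH HiE] := HE i; apply/eqP; rewrite -subr_eq0; apply/eqP.
  apply: fvec_inj; last by rewrite fvecD -scaleN1r fvecZ scaleN1r -SE -HiE subrr.
  by rewrite (leq_trans (size_polyD _ _)) // size_polyN geq_max sG size_lin_mul.
have G_root i : form n G (b i) (- a i) = 0.
  have [sH _] := HE i; have sH' : (size (H i) <= (n - 1).+1)%N by rewrite nE.
  have := formM (b i) (- a i) (size_lin (a i) (b i)) sH'.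
  by rewrite -GE add1n nE form_lin mulrN [b i * _]mulrC subrr mul0r.
have G0_root i : form n G0 (b i) (- a i) = 0.
  rewrite form_prod_lin (bigD1 i) //=.
  by rewrite mulrN [b i * _]mulrC subrr mul0r.
(* [G] and [G0] share the [n] zeros [[b i : - a i]]. The combination [g0 *: G - g *: G0] vanishes
   also at [[p_j0 : r_j0]], indexed by [None], which is not one of them because no [Q i] vanishes at
   [j0]. With [n + 1] distinct zeros it is zero, so [G] is a multiple of [G0]. *)
pose g0 := fvec p r n G0 0 j0; pose g := fvec p r n G 0 j0.
have KE : g0 *: G - g *: G0 = 0.
  pose x k := if k is Some i then b i else p 0 j0.
  pose y k := if k is Some i then - a i else r 0 j0.
  apply: (@form_eq0 F (option 'I_n) n _ x y).
  - rewrite (leq_trans (size_polyD _ _)) // size_polyN geq_max.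
    by rewrite !(leq_trans (size_scale_leq _ _)).
  - by rewrite card_option card_ord.
  - have Qj i : a i * p 0 j0 + b i * r 0 j0 != 0.
      by have := Qj0 i; rewrite QE !mxE.
    move=> [i|] [k|] //= ik.
    + by rewrite !mulrN eqr_opp mulrC [b k * _]mulrC eq_sym; apply: ab.
    + by rewrite mulrN -addr_eq0 addrC mulrC.
    + by rewrite mulrN eq_sym -addr_eq0 addrC [p 0 j0 * _]mulrC.
  move=> k; rewrite formD -scaleN1r !formZ mulN1r; case: k => [i|] /=.
    by rewrite G_root G0_root !mulr0 subrr.
  by rewrite /g0 /g !mxE mulrC subrr.
have SgE : g0 *: rep S = g *: fvec p r n G0.
  apply/eqP; rewrite SE -!fvecZ -subr_eq0 -scaleN1r -fvecZ -fvecD scaleN1r KE.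
  by apply/eqP/rowP=> j; rewrite !mxE form0.
have gn0 : g != 0.
  apply: contraNneq (rep_neq0 S) => g_0; move/eqP: SgE.
  by rewrite g_0 scale0r scaler_eq0 (negPf Gj0).
by rewrite -(mkpointZ _ gn0) -SgE mkpointZ // mkpoint_rep.
Qed.

End Line.

(** * Bases of the line, and the meaning of avoiding [Delta (n - 2)] *)

Section Pencils.
Variables (F : numClosedFieldType) (n : nat).

(** Prescribing [p] lets any chosen point of the line become the point of parameter [t = 0]. *)
Lemma pencil_basis (L : {vspace 'rV[F]_n.+1}) p :
    \dim L = 2 -> p \in L -> p != 0 ->
  exists r, r \notin <[p]>%VS /\
    forall v, v \in L <-> exists a b, v = a *: p + b *: r.
Proof.
move=> dL pL p0; pose D := (L :\: <[p]>)%VS.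
have LE : (<[p]> + D)%VS = L.
  by rewrite addvC addv_diff; apply/addv_idPl; rewrite -memvE.
have dD : \dim D = 1%N.
  have := dimv_cap_compl L <[p]>; rewrite (_ : (L :&: _)%VS = <[p]>%VS).
    by rewrite dim_vline p0 dL add1n => -[].
  by apply/capv_idPr; rewrite -memvE.
have r0 : vpick D != 0 by rewrite vpick0 -dimv_eq0 dD.
have DE : D = <[vpick D]>%VS.
  by apply/esym/eqP; rewrite eqEdim -memvE memv_pick /= dD dim_vline r0.
exists (vpick D); split.
  apply: contra r0 => rp; rewrite -memv0 -(capv_diff L <[p]>) memv_cap rp andbT.
  exact: memv_pick.
move=> v; rewrite -LE {1}DE; split=> [/memv_addP[_ /vlineP[a ->] [_ /vlineP[b ->] ->]]|].
  by exists a, b.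
by case=> a [b ->]; rewrite memv_add // memvZ // memv_line.
Qed.

(** A vanishing minor would produce a non-zero vector of [L] with two zero coordinates, hence with
    at most [n - 1] non-zero ones: a point of [Delta (n - 2)]. *)
Lemma pencil_independent (L : {vspace 'rV[F]_n.+1}) p r :
    (1 < n)%N -> [set P | (val P <= L)%VS] `&` Delta (n - 2) = set0 ->
    p != 0 -> r \notin <[p]>%VS ->
    (forall v, v \in L <-> exists a b, v = a *: p + b *: r) ->
  forall j k, j != k -> p 0 j * r 0 k != p 0 k * r 0 j.
Proof.
move=> n1 LDelta p0 rp LP j k jk; apply/eqP=> pr.
have two_zeros v : v \in L -> v 0 j = 0 -> v 0 k = 0 -> v = 0.
  move=> vL vj vk; apply/eqP; apply: contraT => v0.
  suff : set0 (mkpoint v) by [].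
  rewrite -LDelta; split; first by rewrite /= mkpoint_sub.
  have [c c0 cE] := rep_mkpoint v0.
  suff : (#|[pred l | rep (mkpoint v) 0%R l != 0%R]| + #|[set j; k]%SET| <= n.+1)%N.
    rewrite /Delta /= cards2 jk addn2 ltnS => le_n.
    by rewrite -subSn // subSS leq_subRL ?(ltnW n1).
  rewrite -[X in (_ <= X)%N](card_ord n.+1) -cardUI.
  rewrite [X in (_ + X)%N]eq_card0 ?addn0 ?max_card // => l.
  rewrite !inE cE mxE mulf_eq0 (negPf c0) /=.
  by apply/negP => /andP[+ /orP[] /eqP lE]; rewrite lE ?vj ?vk eqxx.
(* This vector vanishes at [j] by construction and at [k] by the vanishing minor. It gives a
   contradiction unless [p] and [r] both vanish at [j]; then the analogous combination built from
   coordinate [k] is used. *)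
have /two_zeros : r 0 j *: p + (- p 0 j) *: r \in L by apply/LP; exists (r 0 j), (- p 0 j).
rewrite !mxE !mulNr pr ![r 0 j * _]mulrC !subrr.
have [pj|pj] := eqVneq (p 0 j) 0; last first.
  move=> /(_ erefl erefl)/eqP; rewrite scaleNr subr_eq0 => /eqP prE.
  case/negP: rp; apply/vlineP; exists ((p 0 j)^-1 * r 0 j).
  by rewrite -scalerA prE scalerA mulVf ?scale1r.
rewrite pj oppr0 scale0r addr0 => /(_ erefl erefl)/eqP.
rewrite scaler_eq0 (negPf p0) orbF => /eqP rj.
have pL : p \in L by apply/LP; exists 1, 0; rewrite scale1r scale0r addr0.
have rL : r \in L by apply/LP; exists 0, 1; rewrite scale1r scale0r add0r.
have : r 0 k *: p + (- p 0 k) *: r \in L by apply/LP; exists (r 0 k), (- p 0 k).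
move/two_zeros; rewrite !mxE pj rj !mulr0 addr0 mulNr [r 0 k * _]mulrC subrr.
move=> /(_ erefl erefl)/eqP; rewrite scaleNr subr_eq0 => /eqP prE.
have [pk|pk] := eqVneq (p 0 k) 0.
  by case/eqP: p0; apply: two_zeros.
case/negP: rp; apply/vlineP; exists ((p 0 k)^-1 * r 0 k).
by rewrite -scalerA prE scalerA mulVf ?scale1r.
Qed.

End Pencils.

Theorem theorem2p1 (R : realType) (n : nat) (hn : (2 <= n)%N)
    (ell : set (proj_point (complex R) n)) (hell : linear_subspace 1 ell)
    (hDelta : ell `&` @Delta (complex R) n (n - 2)%N = set0) :
  [/\ rational_normal_curve (coord_pow ell n),
      forall P : proj_point (complex R) n, ell P ->
        (forall d : nat, (1 <= d <= n - 1)%N ->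
           let T := hprod [set ppow P (n - d)%N] (hpow ell d) in
           osculating_space d (coord_pow ell n) (ppow P n) T /\
           T `&` coord_pow ell n = [set ppow P n]) /\
        osculating_space (n - 1)%N (coord_pow ell n) (ppow P n)
          (hprod [set P] (hpow ell (n - 1)%N)) &
      forall P : 'I_n -> proj_point (complex R) n,
        injective P -> (forall i, ell (P i)) ->
        (exists j, forall i, rep (P i) 0 j != 0) /\
        [set \big[@hmul (complex R) n/@hone (complex R) n]_(i < n) P i] =
        \bigcap_(i in [set: 'I_n]) hprod [set P i] (hpow ell (n - 1)%N)].
Proof.
have n0 : (0 < n)%N by apply: ltnW.
case: hell hDelta => L dL -> LDelta.
have L0 : vpick L != 0 by rewrite vpick0 -dimv_eq0 dL.
have [r [rp LP]] := pencil_basis dL (memv_pick L) L0.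
have pr := pencil_independent hn LDelta L0 rp LP.
split; first exact: (rnc_coord_pow LP pr n0); last first.
  by move=> P; apply: (product_of_points LP pr n0).
move=> P; rewrite /= sub_rep => PL.
(* The basis is chosen anew so as to begin with the given point [P]. *)
have {L0 r rp LP pr} [r [rp LP]] := pencil_basis dL PL (rep_neq0 P).
have pr := pencil_independent hn LDelta (rep_neq0 P) rp LP.
have main d : (1 <= d <= n - 1)%N ->
    let T := hprod [set ppow P (n - d)%N] (hpow [set P | (val P <= L)%VS] d) in
    osculating_space d (coord_pow [set P | (val P <= L)%VS] n) (ppow P n) T /\
    T `&` coord_pow [set P | (val P <= L)%VS] n = [set ppow P n].
  rewrite subn1 => /andP[d0]; rewrite -ltnS prednK // => dn T.
  have -> : T = [set S | (val S <= osc (rep P) r d)%VS].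
    by apply: (hprod_point_lsys LP); rewrite ?vpow_neq0 ?rep_neq0.
  split; first exact: (osculating_osc LP pr n0 (ltnW dn)).
  exact: (osc_meet LP pr n0 dn).
(* The hyperplane is the case [d = n - 1], where the power of [P] has exponent [n - (n - 1) = 1]. *)
split=> //; have [|+ _] := main (n - 1)%N; first by rewrite leqnn subn_gt0 hn.
by rewrite subKn // ppow1.
Qed.
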